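(* For any embedding $j:X\to K$ into a compact pointed type $K$ and any family $Y:X\to\mathcal U$ of compact pointed types, the extended sum $\Sigma_{k:K}\,(Y/j)\,k$ is compact pointed.
   Context: Foundation: intensional Martin-Löf type theory with $\mathbf 0,\mathbf 1,\mathbf 2$ (points $0,1$), $+,\Pi,\Sigma$, identity types, universes $\mathcal U,\ldots$, and function extensionality (e.g. as in the HoTT Book). No excluded middle is assumed. $j^{-1}(k):=\Sigma_{x:X}(j\,x=k)$ is the fiber of $j$ over $k$; $j$ is an embedding if all its fibers are propositions (types with at most one element). A type $X$ is compact if for every $p:X\to\mathbf 2$ the type $\Sigma_{x:X}\,p\,x=0$ is decidable, where $A$ is decidable if $A+\neg A$. Compact pointed means compact and equipped with a point. The $\Pi$-extension of $Y:X\to\mathcal U$ along $j:X\to K$ is the family $Y/j$ on $K$ with $(Y/j)\,k:=\prod_{(x,p):j^{-1}(k)}Y\,x$. *)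

(* Defs.v *)
(* Martin-Löf type theory is rendered by Rocq's [Type], with [eq] as the
   identity type: although [eq] lands in [Prop], it eliminates into [Type] by
   the full J rule, and no proof irrelevance or excluded middle is assumed.
   The two-point type is [bool], with [false] as the point 0 and [true] as 1. *)

Definition fun_ext : Type :=
  forall (A : Type) (B : A -> Type) (f g : forall x : A, B x),
    (forall x : A, f x = g x) -> f = g.

Definition is_proposition (A : Type) : Type := forall a b : A, a = b.

Definition fiber {X K : Type} (j : X -> K) (k : K) : Type :=
  {x : X & j x = k}.

Definition is_embedding {X K : Type} (j : X -> K) : Type :=
  forall k : K, is_proposition (fiber j k).

(* Data, not a mere proposition: a witness of [A] or a refutation of it. *)
Definition decidable (A : Type) : Type := (A + notT A)%type.

Definition compact (X : Type) : Type :=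
  forall p : X -> bool, decidable {x : X & p x = false}.

Definition compact_pointed (X : Type) : Type := (compact X * X)%type.

Definition pi_extension {X K : Type} (Y : X -> Type) (j : X -> K) (k : K) :
    Type :=
  forall w : fiber j k, Y (projT1 w).

(* Main.v *)
Require Import Defs.

(** Compact types are closed under [sigT], so it suffices that each value
    [pi_extension Y j k] is compact pointed.  That value is a product of
    compact pointed types indexed by the fiber of [j] over [k], a proposition
    that cannot be assumed decidable, and [compact_pointed_product] handles
    such products.

    Its idea is that a compact pointed type has a universal witness for every
    boolean predicate [q]: a point [z0] such that if [q z0 = true] then [q] is
    constantly [true].  Testing [q] at [z0] decides whether [q] has a root.  For
    a product over a proposition [P], any [w : P] makes the product equivalent
    to its factor at [w], so a universal witness can be defined coordinate by
    coordinate, the coordinate at [w] being computed from [w] itself.  It is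
    universal as soon as [P] holds.  If [P] fails then the product has only one
    element, and the witness is trivially universal.  Excluded middle is not
    needed to combine the two cases, since whether [q z] is [true] is decidable:
    a root [z] of [q] refutes [P] by the first case, and is then ruled out by
    the second. *)

(** Universal witnesses turn a search over all of [Z] into a single test.
    Unlike the bare decision, they can be chosen coordinatewise in a product. *)
Definition universal_witness {Z : Type} (q : Z -> bool) : Type :=
  {z0 : Z & q z0 = true -> forall z : Z, q z = true}.

Lemma compact_pointed_universal_witness (Z : Type) (Z_cp : compact_pointed Z)
    (q : Z -> bool) : universal_witness q.
Proof.
  destruct Z_cp as [Z_compact z].
  destruct (Z_compact q) as [[r r_root] | no_root].
  - exists r; congruence.
  - exists z; intros _ x.
    destruct (q x) eqn:qx; [reflexivity | destruct no_root; now exists x].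
Defined.

Lemma compact_of_universal_witness (Z : Type)
    (wit : forall q : Z -> bool, universal_witness q) : compact Z.
Proof.
  intros q; destruct (wit q) as [z0 z0_univ].
  destruct (q z0) eqn:qz0.
  - right; intros [z z_root].
    specialize (z0_univ eq_refl z); congruence.
  - left; now exists z0.
Defined.

Definition spread {P : Type} (P_prop : is_proposition P) {Z : P -> Type}
    (w : P) (y : Z w) : forall w' : P, Z w' :=
  fun w' => eq_rect w Z y w' (P_prop w w').

Lemma spread_coordinate (funext : fun_ext) (P : Type)
    (P_prop : is_proposition P) (Z : P -> Type) (z : forall w : P, Z w)
    (w : P) : spread P_prop w (z w) = z.
Proof.
  apply funext; intros w'; unfold spread.
  now destruct (P_prop w w').
Qed.

(** The Tychonoff theorem for a product indexed by a proposition. *)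
Lemma compact_pointed_product (funext : fun_ext) (P : Type)
    (P_prop : is_proposition P) (Z : P -> Type)
    (Z_cp : forall w : P, compact_pointed (Z w)) :
  compact_pointed (forall w : P, Z w).
Proof.
  split; [| exact (fun w => snd (Z_cp w))].
  apply compact_of_universal_witness; intros q.
  pose (wit := fun w : P =>
    compact_pointed_universal_witness (Z w) (Z_cp w)
      (fun y => q (spread P_prop w y))).
  pose (z0 := fun w : P => projT1 (wit w)).
  exists z0; intros qz0.
  assert (univ_if_P : P -> forall z, q z = true).
  { intros w z.
    rewrite <- (spread_coordinate funext P P_prop Z z w).
    apply (projT2 (wit w)).
    change (q (spread P_prop w (z0 w)) = true).
    now rewrite spread_coordinate. }
  intros z; destruct (q z) eqn:qz; [reflexivity |].
  (* A root of [q] refutes [P], which makes the product a singleton. *)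
  assert (z_eq : z = z0).
  { apply funext; intros w.
    specialize (univ_if_P w z); congruence. }
  congruence.
Defined.

(** The first component is searched with the boolean predicate asking whether
    the fiber over it has a root, available because each fiber is compact. *)
Lemma compact_sigma (K : Type) (Z : K -> Type) (K_compact : compact K)
    (Z_compact : forall k : K, compact (Z k)) : compact {k : K & Z k}.
Proof.
  intros q.
  pose (d := fun k : K => Z_compact k (fun z => q (existT Z k z))).
  destruct (K_compact (fun k => if d k then false else true))
    as [[k k_root] | no_root].
  - destruct (d k) as [[z z_root] | _]; [| discriminate].
    left; now exists (existT Z k z).
  - right; intros [[k z] kz_root].
    apply no_root; exists k.
    destruct (d k) as [_ | no_z]; [reflexivity |].
    destruct no_z; now exists z.
Defined.

Theorem theorem4p33 (funext : fun_ext) (X K : Type) (j : X -> K)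
    (j_emb : is_embedding j) (K_cp : compact_pointed K)
    (Y : X -> Type) (Y_cp : forall x : X, compact_pointed (Y x)) :
  compact_pointed {k : K & pi_extension Y j k}.
Proof.
  assert (ext_cp : forall k, compact_pointed (pi_extension Y j k)).
  { intros k.
    exact (compact_pointed_product funext (fiber j k) (j_emb k)
             (fun w => Y (projT1 w)) (fun w => Y_cp (projT1 w))). }
  destruct K_cp as [K_compact k0]; split.
  - exact (compact_sigma K (pi_extension Y j) K_compact
             (fun k => fst (ext_cp k))).
  - exact (existT _ k0 (snd (ext_cp k0))).
Qed.
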